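(* Let $T$ be an operator semigroup on a set $D$, let $S$ be a $T$-space and let $B\subseteq S$. Then the correspondences $$\gamma: H\mapsto S^{H}\qquad\text{and}\qquad \delta: K\mapsto \operatorname{GMn}_T(S/K)$$ define inclusion-inverting mutually inverse bijective maps between $\operatorname{GSMn}_T(S/B)$ and $\operatorname{Int}_T^{\operatorname{End}}(S/B)$ (that is, $\gamma:\operatorname{GSMn}_T(S/B)\to\operatorname{Int}_T^{\operatorname{End}}(S/B)$ is an inclusion-reversing bijection whose inverse is $\delta$, which is also inclusion-reversing).
   Context: An operator semigroup on a set $D$ is a (possibly empty) set $T$ of functions $D\to D$ closed under composition. For $U\subseteq D$ put $\langle U\rangle_T=\{f(u): f\in T,\ u\in U\}$; a $T$-space is a subset of $D$ of the form $\langle U\rangle_T$ for some $U\subseteq D$. (If $S$ is a $T$-space then $f(a)\in S$ for all $f\in T$, $a\in S$.) A $T$-morphism from a $T$-space $S$ to a $T$-space $S'$ is a map $\sigma:S\to S'$ with $\sigma(f(a))=f(\sigma(a))$ for all $a\in S$, $f\in T$. $\operatorname{End}_T(S)$ is the set of all $T$-morphisms from $S$ to $S$. For $H\subseteq\operatorname{End}_T(S)$, $S^H=\{a\in S:\sigma(a)=a\ \forall\sigma\in H\}$ (so $S^{\emptyset}=S$). For $K\subseteq S$, $\operatorname{GMn}_T(S/K)=\{\sigma\in\operatorname{End}_T(S):\sigma(b)=b\ \forall b\in K\}$. For $B\subseteq S$, $$\operatorname{Int}_T^{\operatorname{End}}(S/B)=\{S^H: H\subseteq\operatorname{End}_T(S),\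 B\subseteq S^H\},\qquad \operatorname{GSMn}_T(S/B)=\{\operatorname{GMn}_T(S/K): B\subseteq K\subseteq S\}.$$ *)

(* Defs.v *)
From mathcomp Require Import all_boot.
From mathcomp Require Import boolp classical_sets functions.

Set Implicit Arguments.
Unset Strict Implicit.
Unset Printing Implicit Defensive.

Local Open Scope classical_set_scope.

Record opsemigroup (D : Type) := OpSemigroup {
  opset :> set (D -> D);
  opset_comp : forall f g, opset f -> opset g -> opset (f \o g) }.

Definition tgen (D : Type) (T : opsemigroup D) (U : set D) : set D :=
  [set f u | f in (T : set (D -> D)) & u in U].

Record tspace (D : Type) (T : opsemigroup D) := TSpace {
  tspace_set :> set D;
  tspace_gen : exists U : set D, tspace_set = tgen T U }.

Lemma tspace_stable (D : Type) (T : opsemigroup D) (S : tspace T)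
  (f : T) (a : S) : val f (val a) \in (S : set D).
Proof.
case: f a => f /= /set_mem Tf [a /= /set_mem Sa]; apply/mem_set.
move: Sa; have [U ->] := tspace_gen S.
case=> g Tg [u Uu <-]; exists (f \o g); first exact: opset_comp.
by exists u.
Qed.

(* The coercion of a set to the subtype of its elements is used throughout:
   [f : T] and [a : S] are elements of T and S. Accordingly, the maps S -> S'
   are honest functions between subtypes, and the subsets of S are [set S]. *)
Definition tact (D : Type) (T : opsemigroup D) (S : tspace T) (f : T) (a : S)
  : S := exist _ (val f (val a)) (tspace_stable f a).

Definition tmorphism (D : Type) (T : opsemigroup D) (S S' : tspace T)
  (sigma : S -> S') : Prop :=
  forall (a : S) (f : T), sigma (tact f a) = tact f (sigma a).

Definition End (D : Type) (T : opsemigroup D) (S : tspace T) : set (S -> S) :=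
  [set sigma | tmorphism sigma].

Definition fixpts (D : Type) (T : opsemigroup D) (S : tspace T)
  (H : set (S -> S)) : set S :=
  [set a | forall sigma, H sigma -> sigma a = a].

Definition GMn (D : Type) (T : opsemigroup D) (S : tspace T) (K : set S)
  : set (S -> S) :=
  [set sigma | End sigma /\ forall b, K b -> sigma b = b].

Definition IntEnd (D : Type) (T : opsemigroup D) (S : tspace T) (B : set S)
  : set (set S) :=
  [set fixpts H | H in [set H : set (S -> S) |
                         H `<=` End (S:=S) /\ B `<=` fixpts H]].

Definition GSMn (D : Type) (T : opsemigroup D) (S : tspace T) (B : set S)
  : set (set (S -> S)) :=
  [set GMn K | K in [set K : set S | B `<=` K]].

(* Main.v *)
Require Import Defs.
From mathcomp Require Import all_boot.
From mathcomp Require Import boolp classical_sets functions.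

(** The relation [sigma a = a] between endomorphisms and points induces an
    antitone Galois connection: for [H] made of endomorphisms, [H] lies in
    [GMn K] exactly when [K] lies in [fixpts H] ([sub_GMn_fixpts]). As in every
    Galois connection, both maps reverse inclusion and each of them takes the
    same value at a set and at its closure under the round trip
    ([GMn_fixptsK], [fixpts_GMnK]); hence they are mutually inverse between
    the sets [GMn K] and the sets [fixpts H] with [H] made of endomorphisms.

    The base set [B] cuts out matching parts of these two families. If [B `<=` K],
    every map in [GMn K] fixes [B], so [gamma] lands in [IntEnd B]; conversely
    a member of [IntEnd B] is a fixed-point set that contains [B], so [delta]
    sends it into [GSMn B]. *)

Local Open Scope classical_set_scope.

Lemma can_set_bij {U V : Type} {A : set U} {C : set V} {f : U -> V}
    {g : V -> U} :
    set_fun A C f -> set_fun C A g ->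
    (forall x, A x -> g (f x) = x) -> (forall y, C y -> f (g y) = y) ->
  set_bij A C f.
Proof.
move=> fAC gCA fK gK; split=> //.
- move=> x y /set_mem Ax /set_mem Ay fxy.
  by rewrite -(fK x Ax) fxy fK.
- by move=> y Cy; exists (g y); [exact: gCA | exact: gK].
Qed.

Section GaloisConnection.
Context {D : Type} {T : opsemigroup D} {S : tspace T}.
Implicit Types (H : set (S -> S)) (K B : set S).

Lemma sub_GMn_fixpts H K : H `<=` @End D T S ->
  (H `<=` GMn K) <-> (K `<=` fixpts H).
Proof.
move=> HE; split=> [HK a Ka sigma /HK[_]|KH sigma Hs]; first exact.
by split=> [|b /KH]; [exact: HE | exact].
Qed.

Lemma GMn_sub_End K : GMn K `<=` @End D T S.
Proof. by move=> sigma []. Qed.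

Lemma sub_fixpts_GMn K : K `<=` fixpts (GMn K).
Proof. by apply/sub_GMn_fixpts => //; exact: GMn_sub_End. Qed.

Lemma sub_GMn_of_fixpts H : H `<=` @End D T S -> H `<=` GMn (fixpts H).
Proof. by move=> HE; apply/sub_GMn_fixpts. Qed.

Lemma fixpts_anti H1 H2 : H1 `<=` H2 -> fixpts H2 `<=` fixpts H1.
Proof. by move=> H12 a fa sigma /H12; exact: fa. Qed.

Lemma GMn_anti K1 K2 : K1 `<=` K2 -> GMn K2 `<=` GMn K1.
Proof. by move=> K12 sigma [sE sK]; split=> // b /K12; exact: sK. Qed.

Lemma GMn_fixptsK K : GMn (fixpts (GMn K)) = GMn K.
Proof.
apply/seteqP; split; first by apply: GMn_anti; exact: sub_fixpts_GMn.
by apply: sub_GMn_of_fixpts; exact: GMn_sub_End.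
Qed.

(** The hypothesis matters: a map in [H] that is not an endomorphism is lost in
    [GMn (fixpts H)], and with it the points that it alone moves may reappear
    among the fixed points. *)
Lemma fixpts_GMnK H : H `<=` @End D T S -> fixpts (GMn (fixpts H)) = fixpts H.
Proof.
move=> HE; apply/seteqP; split; last exact: sub_fixpts_GMn.
by apply: fixpts_anti; exact: sub_GMn_of_fixpts.
Qed.

Lemma fixpts_GSMn B : set_fun (GSMn B) (IntEnd B) (@fixpts D T S).
Proof.
move=> _ [K /= BK <-]; exists (GMn K) => //; split; first exact: GMn_sub_End.
exact: subset_trans BK (@sub_fixpts_GMn K).
Qed.

Lemma GMn_IntEnd B : set_fun (IntEnd B) (GSMn B) (@GMn D T S).
Proof. by move=> _ [H [_ BH] <-]; exists (fixpts H). Qed.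

End GaloisConnection.

Theorem corollary3p2p5 (D : Type) (T : opsemigroup D) (S : tspace T)
    (B : set S) :
  let gamma : set (S -> S) -> set S := @fixpts D T S in
  let delta : set S -> set (S -> S) := @GMn D T S in
  [/\ set_bij (GSMn B) (IntEnd B) gamma,
      set_bij (IntEnd B) (GSMn B) delta,
      (forall H, GSMn B H -> delta (gamma H) = H) /\
      (forall K, IntEnd B K -> gamma (delta K) = K),
      (forall H1 H2, GSMn B H1 -> GSMn B H2 ->
         H1 `<=` H2 -> gamma H2 `<=` gamma H1) &
      (forall K1 K2, IntEnd B K1 -> IntEnd B K2 ->
         K1 `<=` K2 -> delta K2 `<=` delta K1)].
Proof.
move=> gamma delta.
have gammaK H : GSMn B H -> delta (gamma H) = H.
  by move=> [K _ <-]; exact: GMn_fixptsK.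
have deltaK K : IntEnd B K -> gamma (delta K) = K.
  by move=> [H [HE _] <-]; exact: fixpts_GMnK.
split.
- exact: can_set_bij (@fixpts_GSMn _ _ _ B) (@GMn_IntEnd _ _ _ B) gammaK deltaK.
- exact: can_set_bij (@GMn_IntEnd _ _ _ B) (@fixpts_GSMn _ _ _ B) deltaK gammaK.
- by split.
- by move=> H1 H2 _ _; exact: fixpts_anti.
- by move=> K1 K2 _ _; exact: GMn_anti.
Qed.
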